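(* Let $g_1:\mathbb{R}^n\to\mathbb{R}\cup\{+\infty\}$ be proper and lower semicontinuous with $\inf_{x\in\mathbb{R}^n}g_1(x)>-\infty$, let $g_2:\mathbb{R}^n\to\mathbb{R}$ be differentiable with $L$-Lipschitz gradient, let $h:\mathbb{R}^n\to\mathbb{R}$ be convex, and let $f=g_1+g_2-h$. Fix $t>L$ and let $\{x^k\}$ be a sequence generated by the generalized proximal point algorithm (GPPA) for minimizing $f$ with parameter $t$. Then: (i) For any $k\ge 1$, $$f(x^k)-f(x^{k+1})\ \ge\ \frac{t-L}{2}\,\|x^k-x^{k+1}\|^2 .$$ (ii) If $\alpha=\inf_{x\in\mathbb{R}^n}f(x)>-\infty$, then $\lim_{k\to+\infty}f(x^k)=\ell^*\ge\alpha$ (the limit exists) and $\lim_{k\to+\infty}\|x^k-x^{k+1}\|=0$. (iii) If $\alpha=\inf_{x\in\mathbb{R}^n}f(x)>-\infty$ and $\{x^k\}$ is bounded, then every cluster point of $\{x^k\}$ is a critical point of $f$.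
   Context: GPPA: for a proper function $g$ and $t>0$, $\mathbf{prox}_t^{g}(x)=\operatorname{argmin}\{g(u)+\frac t2\|u-x\|^2: u\in\mathbb{R}^n\}$ (a set). A GPPA sequence for $f=g_1+g_2-h$ with parameter $t>L$ ($L$ being the Lipschitz constant of $\nabla g_2$) is any infinite sequence $\{x^k\}_{k\ge0}$ with $x^0\in\operatorname{dom} g_1=\{x: g_1(x)<+\infty\}$ such that, for each $k\ge 0$, there is $y^k\in\partial h(x^k)$ (chosen arbitrarily) with $$x^{k+1}\in\mathbf{prox}_t^{g_1}\Big(x^k-\frac{\nabla g_2(x^k)-y^k}{t}\Big).$$ Subdifferentials: for convex $h$, $\partial h(\bar x)=\{v:\langle v,x-\bar x\rangle\le h(x)-h(\bar x)\ \forall x\}$. For a lower semicontinuous $\psi:\mathbb{R}^n\to\mathbb{R}\cup\{+\infty\}$ and $\bar x\in\operatorname{dom}\psi$, the Fréchet subdifferential is $\partial^F\psi(\bar x)=\{v:\liminf_{x\to\bar x}\frac{\psi(x)-\psi(\bar x)-\langle v,x-\bar x\rangle}{\|x-\bar x\|}\ge0\}$, and the limiting subdifferential is $\partial^L\psi(\bar x)=\{v:\exists\, x^k\to\bar x,\ \psi(x^k)\to\psi(\bar x),\ v^k\in\partial^F\psi(x^k),\ v^k\to v\}$; both are empty if $\bar x\notin\operatorname{dom}\psi$. Critical point: $\bar x\in\operatorname{dom} f$ is a critical point of $f=g_1+g_2-h$ if $[\partial^Lg_1(\bar x)+\nabla g_2(\bar x)]\cap\partial h(\bar x)\neq\emptyset$.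 *)

(* Defs.v *)
From HB Require Import structures.
From mathcomp Require Import all_boot all_order all_algebra.
From mathcomp Require Import all_classical all_reals all_analysis.

Set Implicit Arguments.
Unset Strict Implicit.
Unset Printing Implicit Defensive.

Import Order.TTheory GRing.Theory Num.Theory.
Import numFieldNormedType.Exports.

Local Open Scope classical_set_scope.
Local Open Scope ring_scope.

(* The points of R^n are row vectors.  The library norm `|x| on 'rV[R]_n is
   the sup norm, so the Euclidean norm is defined here; both induce the
   topology of 'rV[R]_n and the same bounded sets. *)
Definition dot (R : realType) (n : nat) (u v : 'rV[R]_n) : R :=
  \sum_(i < n) u ord0 i * v ord0 i.

Definition enorm (R : realType) (n : nat) (u : 'rV[R]_n) : R :=
  Num.sqrt (dot u u).

Definition gradient (R : realType) (n : nat) (g : 'rV[R]_n -> R)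
    (x : 'rV[R]_n) : 'rV[R]_n :=
  \row_(i < n) 'D_(delta_mx ord0 i) g x.

Definition lipschitz_gradient (R : realType) (n : nat) (L : R)
    (g : 'rV[R]_n -> R) : Prop :=
  [/\ 0 <= L, forall x, differentiable g x &
      forall x y, enorm (gradient g x - gradient g y) <= L * enorm (x - y)].

(* Functions into R `|` {+oo} are \bar R-valued functions avoiding -oo. *)
Definition edom (R : realType) (n : nat) (psi : 'rV[R]_n -> \bar R)
    : set 'rV[R]_n :=
  [set x | (psi x < +oo)%E].

Definition proper_fun (R : realType) (n : nat) (psi : 'rV[R]_n -> \bar R)
    : Prop :=
  (forall x, psi x != -oo%E) /\ edom psi !=set0.

Definition prox (R : realType) (n : nat) (t : R) (g : 'rV[R]_n -> \bar R)
    (x : 'rV[R]_n) : set 'rV[R]_n :=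
  let phi u := (g u + (t / 2 * enorm (u - x) ^+ 2)%:E)%E in
  [set p | forall u, (phi p <= phi u)%E].

Definition convex_subdiff (R : realType) (n : nat) (h : 'rV[R]_n -> R)
    (xb : 'rV[R]_n) : set 'rV[R]_n :=
  [set v | forall x, dot v (x - xb) <= h x - h xb].

Definition frechet_subdiff (R : realType) (n : nat) (psi : 'rV[R]_n -> \bar R)
    (xb : 'rV[R]_n) : set 'rV[R]_n :=
  [set v | edom psi xb /\
    (0 <= limf_einf (fun x => (psi x - psi xb - (dot v (x - xb))%:E)
                              * ((enorm (x - xb))^-1)%:E) (xb^'))%E].

Definition limiting_subdiff (R : realType) (n : nat) (psi : 'rV[R]_n -> \bar R)
    (xb : 'rV[R]_n) : set 'rV[R]_n :=
  [set v | edom psi xb /\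
    exists (xs vs : nat -> 'rV[R]_n),
      [/\ xs k @[k --> \oo] --> xb,
          psi (xs k) @[k --> \oo] --> psi xb,
          forall k, frechet_subdiff psi (xs k) (vs k) &
          vs k @[k --> \oo] --> v]].

Definition objective (R : realType) (n : nat) (g1 : 'rV[R]_n -> \bar R)
    (g2 h : 'rV[R]_n -> R) (x : 'rV[R]_n) : \bar R :=
  (g1 x + (g2 x)%:E - (h x)%:E)%E.

Definition critical_point (R : realType) (n : nat) (g1 : 'rV[R]_n -> \bar R)
    (g2 h : 'rV[R]_n -> R) (xb : 'rV[R]_n) : Prop :=
  edom (objective g1 g2 h) xb /\
  [set v + gradient g2 xb | v in limiting_subdiff g1 xb]
    `&` convex_subdiff h xb !=set0.

Definition GPPA_sequence (R : realType) (n : nat) (g1 : 'rV[R]_n -> \bar R)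
    (g2 h : 'rV[R]_n -> R) (t : R) (x : nat -> 'rV[R]_n) : Prop :=
  edom g1 (x 0%N) /\
  forall k, exists2 y, convex_subdiff h (x k) y &
    prox t g1 (x k - t^-1 *: (gradient g2 (x k) - y)) (x k.+1).

(* Main.v *)
Require Import Defs.
From HB Require Import structures.
From mathcomp Require Import all_boot all_order all_algebra.
From mathcomp Require Import all_classical all_reals all_analysis.
From mathcomp Require Import ring lra.

Set Implicit Arguments.
Unset Strict Implicit.
Unset Printing Implicit Defensive.

Import Order.TTheory GRing.Theory Num.Theory.
Import numFieldNormedType.Exports.

Local Open Scope classical_set_scope.
Local Open Scope ring_scope.

(* Comparing the proximal step with the point [x^k] itself, and using the
   descent lemma for [g2] and the subgradient inequality for [h], makes [f(x^k)]
   decrease by at least [(t - L)/2 |x^k - x^(k+1)|^2], so when [f] is bounded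
   below the values converge and the steps tend to [0].  Near a cluster point
   [xb] the subgradients [y^k] are bounded, since [h] is locally Lipschitz, so
   along a subsequence [x^k -> xb] and [y^k -> yb].  Comparing the proximal step
   with [xb] and using lower semicontinuity gives [g1(x^(k+1)) -> g1(xb)]; the
   Frechet subgradients [t (x^k - x^(k+1)) - grad g2(x^k) + y^k] of [g1] at
   [x^(k+1)] then converge to [yb - grad g2(xb)], and [yb] is a subgradient of
   [h] at [xb]. *)

(** * Euclidean inner product and norm on row vectors *)

Section Euclidean.
Context {R : realType} {n : nat}.
Implicit Types (u v w : 'rV[R]_n) (a : R).

Lemma dotC u v : dot u v = dot v u.
Proof. by apply: eq_bigr => i _; rewrite mulrC. Qed.

Lemma dotDl u v w : dot (u + v) w = dot u w + dot v w.
Proof. by rewrite -big_split; apply: eq_bigr => i _; rewrite mxE mulrDl. Qed.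

Lemma dotZl a u v : dot (a *: u) v = a * dot u v.
Proof. by rewrite mulr_sumr; apply: eq_bigr => i _; rewrite mxE mulrA. Qed.

Lemma dotNl u v : dot (- u) v = - dot u v.
Proof. by rewrite -scaleN1r dotZl mulN1r. Qed.

Lemma dotDr u v w : dot u (v + w) = dot u v + dot u w.
Proof. by rewrite dotC dotDl !(dotC u). Qed.

Lemma dotZr a u v : dot u (a *: v) = a * dot u v.
Proof. by rewrite dotC dotZl dotC. Qed.

Lemma dotNr u v : dot u (- v) = - dot u v.
Proof. by rewrite dotC dotNl dotC. Qed.

Definition dotE := (dotDl, dotDr, dotNl, dotNr, dotZl, dotZr).

Lemma dot_ge0 u : 0 <= dot u u.
Proof. by apply: sumr_ge0 => i _; rewrite -expr2 sqr_ge0. Qed.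

Lemma sqr_enorm u : enorm u ^+ 2 = dot u u.
Proof. by rewrite sqr_sqrtr ?dot_ge0. Qed.

Lemma enorm_ge0 u : 0 <= enorm u.
Proof. exact: sqrtr_ge0. Qed.

Lemma enormZ a u : enorm (a *: u) = `|a| * enorm u.
Proof.
by rewrite /enorm dotZl dotZr mulrA -expr2 sqrtrM ?sqr_ge0// sqrtr_sqr.
Qed.

Lemma coord_le_enorm u i : `|u ord0 i| <= enorm u.
Proof.
rewrite -sqrtr_sqr ler_wsqrtr// expr2 /dot (bigD1 i)//= lerDl.
by apply: sumr_ge0 => j _; rewrite -expr2 sqr_ge0.
Qed.

Lemma norm_le_enorm u : `|u| <= enorm u.
Proof.
rewrite [leLHS]/Num.norm /= mx_normrE; apply/bigmax_leP; split.
  exact: enorm_ge0.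
by move=> [i j] _ /=; rewrite ord1 coord_le_enorm.
Qed.

Lemma enorm_eq0 u : enorm u = 0 -> u = 0.
Proof.
by move=> u0; apply/normr0_eq0/eqP; rewrite eq_le normr_ge0 -u0 norm_le_enorm.
Qed.

(** Cauchy-Schwarz: for nonzero vectors, expanding [0 <= | |v| u - |u| v |^2] gives
    [0 <= 2 |u| |v| (|u| |v| - <u, v>)], and the positive factor is cancelled. *)
Lemma dot_le_enorm u v : dot u v <= enorm u * enorm v.
Proof.
have [v0|v0] := eqVneq (enorm v) 0.
  by rewrite v0 mulr0 (enorm_eq0 v0) -(scale0r 0) dotZr mul0r.
have vp : 0 < enorm v by rewrite lt_def v0 enorm_ge0.
have [u0|u0] := eqVneq (enorm u) 0.
  by rewrite u0 mul0r (enorm_eq0 u0) -(scale0r 0) dotZl mul0r.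
have up : 0 < enorm u by rewrite lt_def u0 enorm_ge0.
have := dot_ge0 (enorm v *: u - enorm u *: v).
rewrite !dotE -!sqr_enorm (dotC v u) => H.
have uv : 0 < enorm u * enorm v by rewrite mulr_gt0.
rewrite -(ler_pM2l uv); nra.
Qed.

Section Limits.
Context {T : Type} {F : set_system T} {FF : Filter F}.
Implicit Types x y : T -> 'rV[R]_n.

Lemma cvg_dot x y (a b : 'rV[R]_n) : x @ F --> a -> y @ F --> b ->
  dot (x k) (y k) @[k --> F] --> dot a b.
Proof.
move=> xa yb.
have coord (z : T -> 'rV[R]_n) (c : 'rV[R]_n) i :
    z @ F --> c -> (z k ord0 i : R) @[k --> F] --> (c ord0 i : R).
  by move=> zc; have := cvg_comp _ _ zc (@coord_continuous R 1 n ord0 i c).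
apply: cvg_big => [|i _]; first exact: add_continuous.
by apply: cvgM; exact: coord.
Qed.

Lemma cvg_enorm x (a : 'rV[R]_n) : x @ F --> a ->
  enorm (x k) @[k --> F] --> enorm a.
Proof.
move=> xa; apply: (cvg_comp _ _ (cvg_dot xa xa)); exact: sqrt_continuous.
Qed.

(** The topology of ['rV[R]_n] comes from the sup norm, which the Euclidean norm dominates. *)
Lemma cvg_enorm0 x (a : 'rV[R]_n) : enorm (x k - a) @[k --> F] --> 0 ->
  x @ F --> a.
Proof.
move=> xa; apply/cvgrPdist_lt => e e0.
have /cvgrPdist_lt/(_ _ e0) := xa; apply: filterS => k.
rewrite sub0r normrN ger0_norm ?enorm_ge0// distrC => /(le_lt_trans _); apply.
exact: norm_le_enorm.
Qed.
End Limits.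
End Euclidean.

(** * Gradients, and the quadratic upper bound for smooth functions *)

Section Descent.
Context {R : realType} {n : nat}.
Implicit Types (u v x d : 'rV[R]_n) (g : 'rV[R]_n -> R).

Lemma derive_gradient g x d : differentiable g x ->
  'D_d g x = dot (gradient g x) d.
Proof.
move=> dg; rewrite deriveE// {1}(row_sum_delta d) linear_sum /dot.
by apply: eq_bigr => i _; rewrite linearZ mxE deriveE// mulrC.
Qed.

Lemma is_derive_line g x d (s : R) : (forall z, differentiable g z) ->
  is_derive s 1 (fun r : R => g (x + r *: d)) (dot (gradient g (x + s *: d)) d).
Proof.
move=> dg; rewrite -derive_gradient//.
(* The difference quotient of the restriction to the line at [s] is that of [g] at [x + s d] in
   direction [d], so derivability and value both carry over. *)
have E : (fun h : R =>
    h^-1 *: (((fun r : R => g (x + r *: d)) \o shift s) (h *: 1)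
             - g (x + s *: d))) =
  (fun h => h^-1 *: ((g \o shift (x + s *: d)) (h *: d) - g (x + s *: d))).
  apply/funext => h; rewrite /= [h *: 1]mulr1 scalerDl.
  by congr (_ *: (g _ - _)); rewrite addrCA.
by split; [rewrite /derivable E; exact: diff_derivable | rewrite /derive E].
Qed.

(* Along the segment [x + s d] the derivative of the difference of the two
   sides is [<grad g (x + s d) - grad g x, d> - L s |d|^2 <= 0]. *)
Lemma descent_lemma g (L : R) x d : lipschitz_gradient L g ->
  g (x + d) <= g x + dot (gradient g x) d + L / 2 * enorm d ^+ 2.
Proof.
move=> [L0 dg lipg].
pose df s := dot (gradient g (x + s *: d)) d
  - (dot (gradient g x) d + L * enorm d ^+ 2 * s).
pose f s : R := g (x + s *: d)
  - (dot (gradient g x) d * s + L / 2 * enorm d ^+ 2 * s ^+ 2).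
have df_f (s : R) : is_derive s (1 : R) f (df s).
  apply: is_deriveB; first exact: is_derive_line.
  apply: is_derive_eq.
  by rewrite -![_ *: _]/(_ * _); field.
have [|c] := @MVT R f df 0 1 ltr01 (fun s _ => df_f s).
  by apply: derivable_within_continuous => s _; exact: ex_derive.
rewrite in_itv /= => /andP[c0 c1].
rewrite /f scale1r scale0r addr0 subr0 mulr1 => E.
suff : df c <= 0 by rewrite !expr2 in E *; lra.
rewrite /df opprD addrA -dotNl -dotDl subr_le0.
apply: le_trans (dot_le_enorm _ _) _.
have -> : L * enorm d ^+ 2 * c = L * (c * enorm d) * enorm d by ring.
rewrite ler_wpM2r ?enorm_ge0//.
have := lipg (x + c *: d) x.
by rewrite addrAC subrr add0r enormZ ger0_norm// ltW.
Qed.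
End Descent.

(** * Finite convex functions: Lipschitz bounds, continuity, bounded subgradients *)

Section Convex.
Context {R : realType}.

Lemma convex_functionP (E : lmodType R) (h : E -> R) : convex_function setT h ->
  forall (s : R) (x y : E), 0 <= s <= 1 ->
    h (s *: x + (1 - s) *: y) <= s * h x + (1 - s) * h y.
Proof.
move=> ch s x y /andP[s0 s1].
by have := ch (Itv01 s0 s1) x y; rewrite !inE; apply.
Qed.

Lemma convex_midpoint (E : lmodType R) (h : E -> R) : convex_function setT h ->
  forall x u, 2 * h x <= h (x + u) + h (x - u).
Proof.
move=> /convex_functionP ch x u; have := ch 2^-1 (x + u) (x - u).
have -> : 2^-1 *: (x + u) + (1 - 2^-1) *: (x - u) = x.
  have -> : 1 - 2^-1 = 2^-1 :> R by field.
  rewrite -scalerDr addrACA subrr addr0 -mulr2n -(scaler_nat 2 x).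
  by rewrite scalerA mulVf ?scale1r.
have half : 0 <= (2^-1 : R) <= 1 by apply/andP; split; lra.
by move=> /(_ half); lra.
Qed.

(* Induction on [s]: the point [x + c e + v] is the midpoint of [x + 2 c e] and
   [x + 2 v]. *)
Lemma convex_bounded_box (E : lmodType R) (I : Type) (h : E -> R) (x : E)
    (e : I -> E) (s : seq I) : convex_function setT h ->
  forall r : R, 0 < r -> exists M : R,
    forall c : I -> R, (forall i, `|c i| <= r) ->
    h (x + \sum_(i <- s) c i *: e i) <= M.
Proof.
move=> hc; have ch := convex_functionP hc; elim: s => [|i s IH] r r0.
  by exists (h x) => c _; rewrite big_nil addr0.
have [M HM] := IH (2 * r) ltac:(lra).
set a := h (x + (2 * r) *: e i); set b := h (x - (2 * r) *: e i).
exists (2^-1 * Num.max a b + (1 - 2^-1) * M) => c cr.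
have -> : x + \sum_(j <- i :: s) c j *: e j =
    2^-1 *: (x + (2 * c i) *: e i) +
    (1 - 2^-1) *: (x + \sum_(j <- s) (2 * c j) *: e j).
  have -> : 1 - 2^-1 = 2^-1 :> R by field.
  rewrite big_cons -scalerDr addrACA -mulr2n -(scaler_nat 2 x).
  rewrite 2!scalerDr !scalerA mulKf// mulVf// scale1r; congr (_ + (_ + _)).
  by rewrite scaler_sumr; apply: eq_bigr => j _; rewrite scalerA mulKf.
apply: le_trans (ch _ _ _ _) _; first by apply/andP; split; lra.
have /HM HM' j : `|2 * c j| <= 2 * r by rewrite normrM ger0_norm// ler_pM2l.
have abM : h (x + (2 * c i) *: e i) <= Num.max a b.
  have := cr i; rewrite ler_norml => /andP[c1 c2].
  (* Since [|c i| <= r], the point [x + 2 c_i e_i] lies between [x - 2 r e_i] and [x + 2 r e_i]; [l]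
     is its affine coordinate on that segment. *)
  pose l := (c i + r) / (2 * r).
  have l01 : 0 <= l <= 1.
    by rewrite /l divr_ge0 ?ler_pdivrMr ?mul1r/=; lra.
  have -> : x + (2 * c i) *: e i =
     l *: (x + (2 * r) *: e i) + (1 - l) *: (x - (2 * r) *: e i).
    rewrite !scalerDr addrACA -scalerDl (addrC l) subrK scale1r; congr (_ + _).
    rewrite scalerN !scalerA -scaleNr -scalerDl; congr (_ *: _).
    by rewrite /l; field; lra.
  apply: le_trans (ch _ _ _ l01) _.
  have am : a <= Num.max a b by rewrite le_max lexx.
  have bm : b <= Num.max a b by rewrite le_max lexx orbT.
  rewrite -/a -/b; nra.
lra.
Qed.

Section RowVectors.
Context {n : nat} (h : 'rV[R]_n -> R) (hc : convex_function setT h).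
Implicit Types x u : 'rV[R]_n.

Lemma coord_le_norm u i : `|u ord0 i| <= `|u|.
Proof.
rewrite [leRHS]/Num.norm /= mx_normrE.
exact: (le_bigmax _ (fun ij : 'I_1 * 'I_n => `|u ij.1 ij.2|) (ord0, i)).
Qed.

Lemma convex_bounded_above x :
  exists M, forall u, `|u| <= 1 -> h (x + u) <= M.
Proof.
have [M HM] := convex_bounded_box x (fun i => delta_mx ord0 i) (enum 'I_n)
  hc ltr01.
exists M => u u1; rewrite (row_sum_delta u) -big_enum /=.
by apply: HM => i; exact: le_trans (coord_le_norm u i) u1.
Qed.

(** The point [x + v] lies on the segment from [x] to [x + v / |v|], where [h] is at most [M];
    convexity then bounds the increase by [(M - h x) |v|]. The lower bound is this upper bound at
    [- u] combined with the midpoint inequality. *)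
Lemma convex_lipschitz_at x : exists2 K, 0 <= K &
  forall u, `|u| <= 1 -> `|h (x + u) - h x| <= K * `|u|.
Proof.
have [M HM] := convex_bounded_above x.
have M0 : 0 <= M - h x by rewrite subr_ge0 -{1}(addr0 x) HM ?normr0.
exists (M - h x) => // u u1.
have up v : `|v| <= 1 -> h (x + v) - h x <= (M - h x) * `|v|.
  move=> v1; have [->|v0] := eqVneq v 0.
    by rewrite addr0 subrr normr0 mulr0.
  have vp : `|v| != 0 by rewrite normr_eq0.
  have -> : x + v = `|v| *: (x + `|v|^-1 *: v) + (1 - `|v|) *: x.
    rewrite scalerDr scalerA divff// scale1r addrAC -scalerDl.
    by rewrite (addrC `|v|) subrK scale1r.
  have := convex_functionP hc (x + `|v|^-1 *: v) x (s := `|v|).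
  rewrite normr_ge0 v1 => /(_ isT) H.
  have := HM (`|v|^-1 *: v).
  rewrite normrZ normfV normr_id mulVf// lexx => /(_ isT) H'.
  have := ler_wpM2l (normr_ge0 v) H'; lra.
have := up u u1; have := up (- u); rewrite normrN => /(_ u1).
have := convex_midpoint hc x u => ? ? ?.
by rewrite ler_norml; lra.
Qed.

Lemma convex_continuous : continuous h.
Proof.
move=> x; have [K K0 HK] := convex_lipschitz_at x.
apply: (proj2 (@cvgrPdist_lt _ _ _ (nbhs x) _ h (h x))) => e e0.
(* Dividing by [K + 1] covers the case [K = 0]. *)
have d0 : 0 < Num.min 1 (e / (K + 1)).
  by rewrite lt_min ltr01 divr_gt0//; lra.
have /cvgrPdist_lt/(_ _ d0) : y @[y --> x] --> x by exact: cvg_id.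
apply: filterS => y; rewrite distrC lt_min => /andP[y1 y2].
have := HK (y - x) (ltW y1).
rewrite (addrC x) subrK distrC => /le_lt_trans; apply.
move: y2; rewrite ltr_pdivlMr; last lra.
have := normr_ge0 (y - x); nra.
Qed.

(** Testing a subgradient at [z] against [z + s e_j] with [s = 1/2] and [s = -1/2] gives
    [s y_j <= 2 K], hence [|y_j| <= 4 K]. The radius 1/2 keeps [z] and the test points in the unit
    ball around [x], where [h] stays within [K] of [h x]. *)
Lemma subdiff_locally_bounded x : exists C : R,
  forall z y, `|z - x| <= 2^-1 -> convex_subdiff h z y -> `|y| <= C.
Proof.
have [K K0 HK] := convex_lipschitz_at x.
exists (4 * K) => z y zx hy.
rewrite [leLHS]/Num.norm /= mx_normrE; apply/bigmax_leP; split; first lra.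
have bnd w : `|w - x| <= 1 -> `|h w - h x| <= K.
  move=> w1; have := HK (w - x) w1; rewrite (addrC x) subrK => /le_trans; apply.
  by rewrite ler_piMr.
move=> [i j] _ /=; rewrite ord1.
have test (s : R) : `|s| = 2^-1 -> s * y ord0 j <= 2 * K.
  move=> s2; have := hy (z + s *: delta_mx ord0 j).
  have -> : dot y (z + s *: delta_mx ord0 j - z) = s * y ord0 j.
    rewrite addrAC subrr add0r dotZr; congr (_ * _).
    rewrite /dot (bigD1 j)//= mxE !eqxx mulr1 big1 ?addr0// => k kj.
    by rewrite mxE (negPf kj) andbF mulr0.
  move=> /le_trans; apply.
  have nz : `|z - x| <= 1 by lra.
  have := bnd _ nz; rewrite ler_norml => /andP[? ?].
  have : `|z + s *: delta_mx ord0 j - x| <= 1.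
    rewrite addrAC (le_trans (ler_normD _ _))// normrZ s2.
    have : `|delta_mx ord0 j : 'rV[R]_n| <= 1.
      rewrite [leLHS]/Num.norm /= mx_normrE; apply/bigmax_leP; split => //.
      move=> [a b] _ /=; rewrite mxE.
      by case: (_ && _); rewrite ?normr1 ?normr0.
    lra.
  move=> /bnd; rewrite ler_norml => /andP[? ?]; lra.
have t1 : `|2^-1 : R| = 2^-1 by rewrite ger0_norm.
have := test _ t1; have := test (- 2^-1); rewrite normrN => /(_ t1).
by rewrite ler_norml; lra.
Qed.

End RowVectors.
End Convex.

(** * Limits of subgradients, and subsequences reaching a cluster point *)

Lemma subdiff_closed (R : realType) (n : nat) (h : 'rV[R]_n -> R)
    (x y : nat -> 'rV[R]_n) (xb yb : 'rV[R]_n) :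
  {for xb, continuous h} -> x @ \oo --> xb -> y @ \oo --> yb ->
  (forall k, convex_subdiff h (x k) (y k)) -> convex_subdiff h xb yb.
Proof.
move=> ch xxb yyb hxy z.
have l1 : dot (y k) (z - x k) @[k --> \oo] --> dot yb (z - xb).
  by apply: cvg_dot => //; apply: cvgB => //; exact: cvg_cst.
have l2 : h z - h (x k) @[k --> \oo] --> h z - h xb.
  by apply: cvgB; [exact: cvg_cst | exact: (cvg_comp _ _ xxb ch)].
by apply: (ler_cvg_to l1 l2); apply: nearW => k; exact: hxy.
Qed.

(** [phi j] is some index [k >= j] with [u k] within [1/(j+1)] of [a]. It need not be increasing:
    tending to infinity is enough to compose limits. *)
Lemma cluster_subsequence (R : realType) (V : normedModType R)
    (u : nat -> V) (a : V) :
  cluster (u @ \oo) a ->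
  exists phi : nat -> nat, phi @ \oo --> \oo /\ u (phi j) @[j --> \oo] --> a.
Proof.
move=> ua.
have /choice[phi Hphi] (j : nat) :
    exists k, (j <= k)%N /\ `|a - u k| < j.+1%:R^-1.
  have [||_ [[k jk <-] ak]] :=
    ua (u @` [set k | (j <= k)%N]) (ball a j.+1%:R^-1).
  - by exists j => // k /= jk; exists k.
  - by apply: nbhsx_ballx; rewrite invr_gt0.
  by exists k; split => //; move: ak; rewrite -ball_normE.
exists phi; split.
  move=> A [N _ NA]; exists N => // j /= Nj; apply: NA => /=.
  exact: leq_trans Nj (Hphi j).1.
apply/cvgrPdist_lt => e e0.
have := near_infty_natSinv_lt (PosNum e0); apply: filterS => j /=.
exact: lt_trans (Hphi j).2.
Qed.

(** * Optimality conditions for a proximal step *)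

Section Prox.
Context {R : realType} {n : nat}.
Implicit Types (g : 'rV[R]_n -> \bar R) (z p u w a : 'rV[R]_n).

(** Expanding the square around [a] produces the linear term [<w, u - a>] and a finite constant [c]
    independent of [u], which cancels. *)
Lemma prox_linearized (t : R) g a w p : 0 < t ->
  prox t g (a - t^-1 *: w) p -> forall u,
  (g p + (dot w (p - a) + t / 2 * enorm (p - a) ^+ 2)%:E <=
   g u + (dot w (u - a) + t / 2 * enorm (u - a) ^+ 2)%:E)%E.
Proof.
move=> t0 pp u; pose c := t / 2 * enorm (t^-1 *: w) ^+ 2.
have E v : (g v + (t / 2 * enorm (v - (a - t^-1 *: w)) ^+ 2)%:E =
    g v + (dot w (v - a) + t / 2 * enorm (v - a) ^+ 2)%:E + c%:E)%E.
  rewrite -addeA -EFinD; congr (_ + _%:E)%E.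
  rewrite opprB addrCA addrC /c !sqr_enorm !(dotDl (v - a)) !(dotDr _ (v - a)).
  rewrite (dotC (v - a) (t^-1 *: w)) !dotZl; field; exact: lt0r_neq0.
by have := pp u; rewrite /= !E leeD2rE.
Qed.

(** Expanding [|u - z|^2] around [p], minimality bounds the Frechet quotient at [u] below by
    [- (t / 2) |u - p|], which tends to 0. *)
Lemma prox_frechet_subdiff (t : R) g z p : 0 < t -> g p \is a fin_num ->
  prox t g z p -> frechet_subdiff g p (t *: (z - p)).
Proof.
move=> t0 gp pp; split; first by rewrite /edom /= ltey_eq gp.
rewrite limf_einfE; apply/lee_subgt0Pr => e e0; rewrite sub0e.
apply: le_trans (ereal_sup_ubound _); last first.
  (* The lower limit is a supremum over neighbourhoods; on this one [(t / 2) |u - p| < e]. *)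
  exists [set u | u != p /\ enorm (u - p) < 2 * e / t]; last by [].
  have r0 : 0 < 2 * e / t by rewrite divr_gt0// mulr_gt0.
  have : enorm (u - p) @[u --> p] --> 0.
    have -> : 0 = enorm (p - p).
      by rewrite subrr -(scale0r p) enormZ normr0 mul0r.
    exact: (@cvg_enorm R n _ (nbhs p) _ _ _ (cvgB cvg_id (cvg_cst p))).
  move=> /cvgrPdist_lt/(_ _ r0); rewrite /dnbhs /within /=.
  apply: filterS => u; rewrite sub0r normrN ger0_norm ?enorm_ge0//.
apply: le_ereal_inf_tmp => _ [u [up ue] <-].
have eu : 0 < enorm (u - p).
  rewrite lt_def enorm_ge0 andbT; apply: contra_neq up => /enorm_eq0/eqP.
  by rewrite subr_eq0 => /eqP.
have := pp u; rewrite /=; case: (g p) gp => [r||] // _; case: (g u) => [s||].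
- rewrite -!EFinD -EFinM !lee_fin.
  have -> : enorm (u - z) ^+ 2 =
      enorm (u - p) ^+ 2 + 2 * dot (p - z) (u - p) + enorm (p - z) ^+ 2.
    rewrite -(subrKA p u) !sqr_enorm !(dotDl (u - p)) !(dotDr _ (u - p)).
    by rewrite (dotC (u - p) (p - z)); ring.
  rewrite -(opprB z p) dotNl dotZl ler_pdivlMr//.
  move: ue; rewrite ltr_pdivlMr// => ue.
  nra.
- by move=> _; rewrite gt0_mulye ?leey// lte_fin invr_gt0.
- by rewrite leeNy_eq.
Qed.
End Prox.

Lemma gradient_continuous (R : realType) (n : nat) (L : R) (g : 'rV[R]_n -> R)
    (T : Type) (F : set_system T) (FF : Filter F) (x : T -> 'rV[R]_n)
    (a : 'rV[R]_n) :
  lipschitz_gradient L g -> x @ F --> a ->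
  gradient g (x k) @[k --> F] --> gradient g a.
Proof.
move=> [L0 _ lipg] xa; apply: cvg_enorm0.
have lim0 : L * enorm (x k - a) @[k --> F] --> 0.
  have -> : 0 = L * enorm (a - a).
    by rewrite subrr -(scale0r a) enormZ normr0 mul0r mulr0.
  by apply: cvgMl_tmp; apply: cvg_enorm; apply: cvgB => //; exact: cvg_cst.
apply: (squeeze_cvgr _ (cvg_cst 0) lim0).
by apply: nearW => k; rewrite enorm_ge0 /=.
Qed.

(** * Descent along the iterates and criticality of cluster points *)

Section Iteration.
Context {R : realType} {n : nat} (g1 : 'rV[R]_n -> \bar R)
  (g2 h : 'rV[R]_n -> R) (L t : R) (x y : nat -> 'rV[R]_n).
Hypotheses (g1_proper : proper_fun g1) (g1_lsc : lower_semicontinuous g1)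
  (g2_smooth : lipschitz_gradient L g2) (h_convex : convex_function setT h)
  (ltLt : L < t) (x0_dom : edom g1 (x 0%N))
  (y_subdiff : forall k, convex_subdiff h (x k) (y k)).
Let w k := gradient g2 (x k) - y k.
Hypothesis x_prox : forall k, prox t g1 (x k - t^-1 *: w k) (x k.+1).

Let t_gt0 : 0 < t.
Proof. by case: g2_smooth => L0 _ _; exact: le_lt_trans ltLt. Qed.

(** [fine] would send an infinite value to 0; [iterate_fin_num] rules this out along the
    sequence. *)
Let G k : R := fine (g1 (x k)).
Let f k : R := G k + g2 (x k) - h (x k).
(** Up to an additive constant, this is what the [k]-th proximal step adds to [g1]; it vanishes at
    [u = x k]. *)
Let model k u : R := dot (w k) (u - x k) + t / 2 * enorm (u - x k) ^+ 2.

(** A proximal point does at least as well as [x 0], where [g1] is finite, so its value cannot be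
    [+oo]; properness excludes [-oo]. *)
Lemma iterate_fin_num k : g1 (x k) = (G k)%:E.
Proof.
rewrite fineK//; have g1x0 : g1 (x 0%N) \is a fin_num.
  by rewrite fin_numE g1_proper.1 -ltey.
case: k => [//|k]; have := prox_linearized t_gt0 (x_prox k) (x 0%N).
have := g1_proper.1 (x k.+1).
by case: (g1 (x k.+1)) => [//||//] _; rewrite -(fineK g1x0) -EFinD leye_eq.
Qed.

Lemma iterate_optimality k u r : g1 u = r%:E ->
  G k.+1 + model k (x k.+1) <= r + model k u.
Proof.
move=> ur; have := prox_linearized t_gt0 (x_prox k) u.
by rewrite ur iterate_fin_num -!EFinD lee_fin.
Qed.

Lemma objective_iterate k : objective g1 g2 h (x k) = (f k)%:E.
Proof. by rewrite /objective iterate_fin_num. Qed.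

(** Adding the three inequalities cancels the linear terms in [gradient g2 (x k)] and [y k]; the
    quadratic terms leave [t / 2 - L / 2]. *)
Lemma sufficient_decrease k :
  (t - L) / 2 * enorm (x k - x k.+1) ^+ 2 <= f k - f k.+1.
Proof.
have := iterate_optimality k (iterate_fin_num k).
have := y_subdiff k (x k.+1).
have := descent_lemma (x k) (x k.+1 - x k) g2_smooth.
rewrite addrC subrK /model subrr.
have -> : enorm (x k - x k.+1) = enorm (x k.+1 - x k).
  by rewrite -opprB -scaleN1r enormZ normrN normr1 mul1r.
rewrite -(scale0r 0) enormZ dotZr /w dotDl dotNl /f normr0 !expr2.
lra.
Qed.

Lemma objective_converges : (-oo < ereal_inf (range (objective g1 g2 h)))%E ->
  exists2 l : R, f @ \oo --> (l : R) &
    (ereal_inf (range (objective g1 g2 h)) <= l%:E)%E.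
Proof.
move=> alpha_gt.
have le_f k : (ereal_inf (range (objective g1 g2 h)) <= (f k)%:E)%E.
  by rewrite -objective_iterate; apply: ereal_inf_lbound; exists (x k).
(* An infimum equal to [+oo] is impossible, being at most the real number [f 0]. *)
case: (ereal_inf _) alpha_gt le_f => [a||] // _ le_f; last first.
  by have := le_f 0%N; rewrite leye_eq.
have f_noninc : nonincreasing_seq f.
  apply/nonincreasing_seqP => k; rewrite -subr_ge0.
  apply: le_trans (sufficient_decrease k).
  by rewrite mulr_ge0 ?sqr_ge0// divr_ge0// subr_ge0 ltW.
have f_lb : has_lbound (range f).
  by exists a => _ [k _ <-]; rewrite -lee_fin le_f.
exists (inf (range f)); first exact: nonincreasing_cvgn.
rewrite lee_fin; apply: lb_le_inf; first by exists (f 0%N), 0%N.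
by move=> _ [k _ <-]; rewrite -lee_fin le_f.
Qed.

(** Solving [sufficient_decrease] for the step bounds it by the square root of a multiple of
    [f k - f k.+1], a difference of consecutive terms of a convergent sequence. *)
Lemma step_cvg0 (l : R) : f @ \oo --> l ->
  enorm (x k - x k.+1) @[k --> \oo] --> 0.
Proof.
move=> fl; have tL : 0 < (t - L) / 2 by rewrite divr_gt0// subr_gt0.
have bound0 : Num.sqrt (((t - L) / 2)^-1 * (f k - f k.+1)) @[k --> \oo] --> 0.
  have -> : 0 = Num.sqrt (((t - L) / 2)^-1 * (l - l)).
    by rewrite subrr mulr0 sqrtr0.
  have df : ((t - L) / 2)^-1 * (f k - f k.+1) @[k --> \oo] -->
      ((t - L) / 2)^-1 * (l - l).
    by apply: cvgMl_tmp; apply: cvgB => //; rewrite (cvg_shiftS f).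
  by apply: (cvg_comp _ _ df); exact: sqrt_continuous.
apply: (squeeze_cvgr _ (cvg_cst 0) bound0).
apply: nearW => k; rewrite enorm_ge0 /= -[leLHS]ger0_norm ?enorm_ge0//.
rewrite -sqrtr_sqr ler_wsqrtr// ler_pdivlMl//; exact: sufficient_decrease.
Qed.

Lemma cluster_critical xb : enorm (x k - x k.+1) @[k --> \oo] --> 0 ->
  cluster (x @ \oo) xb -> critical_point g1 g2 h xb.
Proof.
move=> dx0 /cluster_subsequence[phi1 [phi1y xphi1]].
have [C hC] := subdiff_locally_bounded h_convex xb.
have yC : \forall j \near \oo, `|y (phi1 j)| <= C.
  have half : 0 < (2^-1 : R) by [].
  have /cvgrPdist_lt/(_ _ half) := xphi1; apply: filterS => j xj.
  by apply: hC (y_subdiff _); rewrite distrC ltW.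
(* The closed ball of radius [C] is compact, and the eventual bound [yC] suffices to get a cluster
   point in it; a second extraction makes the subgradients converge. *)
have [yb [_ /cluster_subsequence[phi2 [phi2y yphi2]]]] :
    [set v : 'rV[R]_n | `|v| <= C] `&` cluster ((y \o phi1) @ \oo) !=set0.
  apply: bounded_closed_compact => //.
  - exists C; split; first exact: num_real.
    by move=> M CM v /= /le_trans; apply; exact: ltW.
  - have := @closed_closed_ball_ R 'rV[R]_n 0 C.
    congr closed; apply/seteqP.
    by split=> v; rewrite /closed_ball_ /= sub0r normrN.
pose phi j := phi1 (phi2 j).
have phiy : phi @ \oo --> \oo by exact: cvg_comp phi2y phi1y.
have xphi : x (phi j) @[j --> \oo] --> xb by exact: cvg_comp phi2y xphi1.
have yphi : y (phi j) @[j --> \oo] --> yb by exact: yphi2.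
have xSphi : x (phi j).+1 @[j --> \oo] --> xb.
  have dx : (x k - x k.+1) @[k --> \oo] --> (0 : 'rV[R]_n).
    by apply: cvg_enorm0; under eq_fun do rewrite subr0.
  rewrite -(subr0 xb).
  have -> : (fun j => x (phi j).+1) =
      (x \o phi) - ((fun k => x k - x k.+1) \o phi).
    by apply/funext => j; rewrite /= !fctE /= opprB addrC subrK.
  by apply: cvgB => //; exact: cvg_comp phiy dx.
have wphi : w (phi j) @[j --> \oo] --> gradient g2 xb - yb.
  by apply: cvgB => //; exact: gradient_continuous g2_smooth xphi.
(* The point [u] may vary with [j], so this covers both a fixed competitor and the iterates
   [x (phi j).+1]; for the latter the limit is 0 by [model0]. *)
have model_cvg (u : nat -> 'rV[R]_n) (a : 'rV[R]_n) : u @ \oo --> a ->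
    model (phi j) (u j) @[j --> \oo] -->
    dot (gradient g2 xb - yb) (a - xb) + t / 2 * enorm (a - xb) ^+ 2.
  move=> ua; have ux : (u j - x (phi j)) @[j --> \oo] --> a - xb by exact: cvgB.
  apply: cvgD; first exact: (cvg_dot wphi ux).
  apply: cvgMl_tmp; rewrite expr2; under eq_fun do rewrite expr2.
  by apply: cvgM; exact: cvg_enorm ux.
have model0 :
    dot (gradient g2 xb - yb) (xb - xb) + t / 2 * enorm (xb - xb) ^+ 2 = 0.
  by rewrite subrr -(scale0r 0) dotZr enormZ normr0 !mul0r expr0n mulr0 addr0.
(* Optimality against [u] bounds the upper limit of [G (phi j).+1]. The competitor is left general:
   [x 0] serves to prove [g1 xb] finite, and only then can [xb] itself be used. *)
have G_lt u r s : g1 u = r%:E ->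
    r + (dot (gradient g2 xb - yb) (u - xb) + t / 2 * enorm (u - xb) ^+ 2)
      < s ->
    \forall j \near \oo, G (phi j).+1 < s.
  move=> ur; set m := (X in r + X < s) => ms.
  have e0 : 0 < s - (r + m) by rewrite subr_gt0.
  have lim :
      (model (phi j) u - model (phi j) (x (phi j).+1)) @[j --> \oo] --> m.
    rewrite -[m]subr0 -model0; apply: cvgB; last exact: model_cvg.
    exact: (model_cvg _ _ (cvg_cst u)).
  have /cvgrPdist_lt/(_ _ e0) := lim; apply: filterS => j.
  rewrite ltr_norml => /andP[+ _].
  have := iterate_optimality (phi j) ur; rewrite /= => ? ?; lra.
have g1_lt a : (a%:E < g1 xb)%E -> \forall j \near \oo, a < G (phi j).+1.
  move=> /g1_lsc[V xbV Va].
  have : \forall j \near \oo, V (x (phi j).+1) by exact: xSphi.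
  by apply: filterS => j /Va; rewrite iterate_fin_num lte_fin.
(* If [g1 xb] were [+oo], lower semicontinuity would push [G (phi j).+1] above the bound [B]
   obtained from [x 0]. *)
have g1xb : g1 xb = (fine (g1 xb))%:E.
  case E : (g1 xb) => [//||]; last by have := g1_proper.1 xb; rewrite E.
  have [B GB] : exists B, \forall j \near \oo, G (phi j).+1 < B.
    by eexists; exact: G_lt (iterate_fin_num 0%N) (ltr_pwDr ltr01 (lexx _)).
  have /g1_lt BG : (B%:E < g1 xb)%E by rewrite E ltry.
  have [j [GjB BGj]] := filter_ex (filterI GB BG).
  by have := lt_trans GjB BGj; rewrite ltxx.
(* The upper estimate is [G_lt] at [u = xb], where the limiting model is 0; the lower one is
   semicontinuity. *)
have Gcvg : G (phi j).+1 @[j --> \oo] --> fine (g1 xb).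
  apply/cvgrPdist_lt => e e0.
  have : (((fine (g1 xb)) - e)%:E < g1 xb)%E by rewrite {2}g1xb lte_fin; lra.
  have /(G_lt _ _ _ g1xb) : fine (g1 xb) + (dot (gradient g2 xb - yb) (xb - xb)
      + t / 2 * enorm (xb - xb) ^+ 2) < fine (g1 xb) + e.
    by rewrite model0 addr0 ltrDl.
  move=> GU /g1_lt; apply: filterS2 GU => j ? ?.
  by rewrite ltr_norml; lra.
split; first by rewrite /edom /= /objective g1xb ltry.
exists yb; split; last first.
  apply: (subdiff_closed _ xphi yphi) => //; exact: convex_continuous.
exists (yb - gradient g2 xb); last by rewrite subrK.
split; first by rewrite /edom /= g1xb ltry.
exists (fun j => x (phi j).+1),
  (fun j => t *: (x (phi j) - t^-1 *: w (phi j) - x (phi j).+1)).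
split => //.
- rewrite g1xb; under eq_fun do rewrite iterate_fin_num.
  by apply: cvg_EFin => //; exact: nearW.
- by move=> j; apply: prox_frechet_subdiff => //; rewrite iterate_fin_num.
(* The limit is written in the form [t (z - p)] of the Frechet subgradients so that it can be taken
   term by term. *)
- have -> : yb - gradient g2 xb =
      t *: (xb - t^-1 *: (gradient g2 xb - yb) - xb).
    rewrite addrAC subrr add0r scalerN scalerA divff ?lt0r_neq0//.
    by rewrite scale1r opprB.
  apply: cvgZl_tmp; apply: cvgB => //; apply: cvgB => //; exact: cvgZl_tmp.
Qed.
End Iteration.

Theorem theorem3p5 (R : realType) (n : nat)
    (g1 : 'rV[R]_n -> \bar R) (g2 h : 'rV[R]_n -> R) (L t : R)
    (x : nat -> 'rV[R]_n)
    (g1_proper : proper_fun g1)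
    (g1_lsc : lower_semicontinuous g1)
    (g1_inf : (-oo < ereal_inf (range g1))%E)
    (g2_smooth : lipschitz_gradient L g2)
    (h_convex : convex_function setT h)
    (ltLt : L < t)
    (x_GPPA : GPPA_sequence g1 g2 h t x) :
  let f := objective g1 g2 h in
  let alpha := ereal_inf (range f) in
  [/\ forall k, (1 <= k)%N ->
        (((t - L) / 2 * enorm (x k - x k.+1) ^+ 2)%:E
           <= f (x k) - f (x k.+1))%E,
      (-oo < alpha)%E ->
        (exists l : R, f (x k) @[k --> \oo] --> l%:E /\ (alpha <= l%:E)%E) /\
        enorm (x k - x k.+1) @[k --> \oo] --> (0 : R) &
      (-oo < alpha)%E -> bounded_fun x ->
        forall xb, cluster (x @ \oo) xb -> critical_point g1 g2 h xb].
Proof.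
have [x0_dom step] := x_GPPA.
have /choice[y Hy] k : exists v, convex_subdiff h (x k) v /\
    prox t g1 (x k - t^-1 *: (gradient g2 (x k) - v)) (x k.+1).
  by have [v hv pv] := step k; exists v.
have y_sub k : convex_subdiff h (x k) (y k) := (Hy k).1.
have x_prox k := (Hy k).2.
have fE := objective_iterate h g1_proper g2_smooth ltLt x0_dom x_prox.
have cvgf := objective_converges g1_proper g2_smooth ltLt x0_dom y_sub x_prox.
have step0 := step_cvg0 g1_proper g2_smooth ltLt x0_dom y_sub x_prox.
move=> f alpha; split.
- move=> k _; rewrite /f !fE -EFinB lee_fin.
  exact: sufficient_decrease g1_proper g2_smooth ltLt x0_dom y_sub x_prox k.
- move=> /cvgf[l fl al]; split; last exact: step0 fl.
  exists l; split => //; rewrite /f; under eq_fun do rewrite fE.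
  by apply: cvg_EFin => //; exact: nearW.
- move=> /cvgf[l fl _] _ xb.
  exact: (cluster_critical g1_proper g1_lsc g2_smooth h_convex ltLt x0_dom y_sub
    x_prox (step0 _ fl)).
Qed.
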